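(* Let $\Omega$ be a bounded domain in $\mathbb{H}$ with boundary of class $C^1$. Let $f=f_1+f_2j:\Omega\to\mathbb{H}$ be a harmonic function on $\Omega$, of class $C^1$ on $\overline\Omega$. Then $f$ is (left-)$\psi$-regular on $\Omega$ if and only if $(\overline\partial_n-jL)f=0$ on $\partial\Omega$.
   Context: Let $\mathbb{H}$ be the quaternions, with basic units $i,j,k$. Identify $\mathbb{C}^2$ with $\mathbb{H}$ by $(z_1,z_2)=(x_0+ix_1,x_2+ix_3)\mapsto q=z_1+z_2j=x_0+ix_1+jx_2+kx_3$; then $aj=j\bar a$ for $a\in\mathbb{C}$. An $\mathbb{H}$-valued function is written $f=f_1+f_2j$ with $f_1,f_2$ complex-valued. Harmonic means harmonic with respect to the Laplacian of $\mathbb{R}^4$ (componentwise). A $C^1$ function $f$ is (left-)$\psi$-regular on $\Omega$ if $\left(\frac{\partial}{\partial\bar z_1}+j\frac{\partial}{\partial\bar z_2}\right)f=0$ on $\Omega$; equivalently $\frac{\partial f_1}{\partial\bar z_1}=\frac{\partial\overline{f_2}}{\partial z_2}$ and $\frac{\partial f_1}{\partial\bar z_2}=-\frac{\partial\overline{f_2}}{\partial z_1}$. $\Omega=\{\rho<0\}$ with $\rho$ a real function of class $C^1$ on $\mathbb{C}^2$ and $d\rho\neq0$ on $\partial\Omega$; $|\overline\partial\rho|^2=\sum_{k=1}^2\left|\frac{\partial\rho}{\partial\bar z_k}\right|^2$. For complex-valued $g$ of class $C^1$ on $\overline\Omega$, on $\partial\Omega$, $$\overline\partial_n g=\frac1{|\overline\partial\rho|}\sum_{k=1}^2\frac{\partial\rho}{\partial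 z_k}\frac{\partial g}{\partial\bar z_k},\qquad L(g)=\frac1{|\overline\partial\rho|}\left(\frac{\partial\rho}{\partial\bar z_2}\frac{\partial g}{\partial\bar z_1}-\frac{\partial\rho}{\partial\bar z_1}\frac{\partial g}{\partial\bar z_2}\right).$$ On $f=f_1+f_2j$ these act by $\overline\partial_n f=\overline\partial_n f_1+(\overline\partial_n f_2)j$ and $L(f)=L(f_1)+L(f_2)j$, and $jL(f)$ is the quaternionic product of $j$ with $L(f)$. *)

(* Defs.v *)
(* MathComp-Analysis, over an arbitrary [R : realType]. *)
From HB Require Import structures.
From mathcomp Require Import all_boot all_order all_algebra.
From mathcomp Require Import all_classical all_reals all_analysis.
From mathcomp Require Import complex.
From mathcomp Require Import ring.
Set Implicit Arguments.
Unset Strict Implicit.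
Unset Printing Implicit Defensive.
Import Order.TTheory GRing.Theory Num.Theory.
Import numFieldNormedType.Exports.
Local Open Scope classical_set_scope.
Local Open Scope ring_scope.
Local Open Scope complex_scope.

Local Notation Re := complex.Re.
Local Notation Im := complex.Im.

(** * Quaternions *)

(* H is R^4 with its usual topology: the row (x0, x1, x2, x3) is
   x0 + i x1 + j x2 + k x3, and at the same time the point
   (z1, z2) = (x0 + i x1, x2 + i x3) of C^2.  The norm of 'rV[R]_4 is the
   sup norm; only the topology and the bounded sets it induces are used. *)
Definition quat (R : realType) : Type := 'rV[R]_4.

HB.instance Definition _ (R : realType) := NormedModule.on (quat R).

Definition mkq (R : realType) (a b c d : R) : quat R :=
  \row_(l < 4) [:: a; b; c; d]`_l.

Section QuatRing.
Variable R : realType.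
Implicit Types p q r : quat R.

Definition oneq : quat R := mkq 1 0 0 0.

(* Hamilton's product: i^2 = j^2 = k^2 = ijk = -1. *)
Definition mulq p q : quat R :=
  mkq (p 0 0 * q 0 0 - p 0 1 * q 0 1 - p 0 2 * q 0 2 - p 0 3 * q 0 3)
      (p 0 0 * q 0 1 + p 0 1 * q 0 0 + p 0 2 * q 0 3 - p 0 3 * q 0 2)
      (p 0 0 * q 0 2 - p 0 1 * q 0 3 + p 0 2 * q 0 0 + p 0 3 * q 0 1)
      (p 0 0 * q 0 3 + p 0 1 * q 0 2 - p 0 2 * q 0 1 + p 0 3 * q 0 0).

Lemma quatP p q :
  p 0 0 = q 0 0 -> p 0 1 = q 0 1 -> p 0 2 = q 0 2 -> p 0 3 = q 0 3 -> p = q.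
Proof.
move=> h0 h1 h2 h3; apply/rowP => -[[|[|[|[|//]]]] hl].
- by rewrite (_ : Ordinal hl = 0)//; exact: val_inj.
- by rewrite (_ : Ordinal hl = 1)//; exact: val_inj.
- by rewrite (_ : Ordinal hl = 2)//; exact: val_inj.
- by rewrite (_ : Ordinal hl = 3)//; exact: val_inj.
Qed.

Lemma mkqE (a b c d : R) :
  (mkq a b c d 0 0 = a) * (mkq a b c d 0 1 = b) *
  (mkq a b c d 0 2 = c) * (mkq a b c d 0 3 = d).
Proof. by rewrite !mxE. Qed.

Let addqE p q l : (p + q) 0 l = p 0 l + q 0 l. Proof. by rewrite mxE. Qed.

Lemma mulqA : associative mulq.
Proof. by move=> p q r; apply: quatP; rewrite !mkqE; ring. Qed.

Lemma mul1q : left_id oneq mulq.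
Proof. by move=> p; apply: quatP; rewrite !mkqE; ring. Qed.

Lemma mulq1 : right_id oneq mulq.
Proof. by move=> p; apply: quatP; rewrite !mkqE; ring. Qed.

Lemma mulqDl : left_distributive mulq +%R.
Proof. by move=> p q r; apply: quatP; rewrite addqE !mkqE !addqE; ring. Qed.

Lemma mulqDr : right_distributive mulq +%R.
Proof. by move=> p q r; apply: quatP; rewrite addqE !mkqE !addqE; ring. Qed.

Lemma oneq_neq0 : oneq != 0.
Proof.
by apply/eqP => /(congr1 (fun q : quat R => q 0 0)); rewrite mkqE mxE; apply/eqP/oner_neq0.
Qed.

HB.instance Definition _ := GRing.Zmodule_isNzRing.Build (quat R)
  mulqA mul1q mulq1 mulqDl mulqDr oneq_neq0.

End QuatRing.

Definition qi (R : realType) : quat R := mkq 0 1 0 0.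
Definition qj (R : realType) : quat R := mkq 0 0 1 0.
Definition qk (R : realType) : quat R := mkq 0 0 0 1.
Arguments qi {R}.
Arguments qj {R}.
Arguments qk {R}.

Definition c2q (R : realType) (a : R[i]) : quat R := mkq (Re a) (Im a) 0 0.

Definition qc1 (R : realType) (q : quat R) : R[i] := q 0 0 +i* q 0 1.
Definition qc2 (R : realType) (q : quat R) : R[i] := q 0 2 +i* q 0 3.

Section QuatFacts.
Variable R : realType.
Implicit Types (a : R[i]) (q : quat R).

Lemma qij : qi * qj = qk :> quat R.
Proof. by apply: quatP; rewrite !mkqE; ring. Qed.

Lemma quatE q : q = c2q (qc1 q) + c2q (qc2 q) * qj.
Proof. by apply: quatP; rewrite mxE !mkqE /=; ring. Qed.

Lemma c2qM a b : c2q (a * b) = c2q a * c2q b.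
Proof. by case: a b => [a a'] [b b']; apply: quatP; rewrite !mkqE /=; ring. Qed.

Lemma c2q_qj a : c2q a * qj = qj * c2q (conjc a).
Proof. by case: a => [a a']; apply: quatP; rewrite !mkqE /=; ring. Qed.

Lemma qj_qj : qj * qj = -1 :> quat R.
Proof. by apply: quatP; rewrite [RHS]mxE !mkqE /=; ring. Qed.

End QuatFacts.

(** * Differential calculus on R^4 *)

Section Calculus.
Variables (R : realType) (W : normedModType R).
Implicit Types (U : set (quat R)) (f : quat R -> W).

Definition evec (l : 'I_4) : quat R := delta_mx 0 l.

Definition partial (l : 'I_4) f : quat R -> W := 'D_(evec l) f.

Definition C1_on U f : Prop :=
  forall x, U x -> differentiable f x /\
    forall l, {for x, continuous (partial l f)}.

Definition C2_on U f : Prop :=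
  C1_on U f /\ forall l, C1_on U (partial l f).

Definition laplacian f (x : quat R) : W :=
  \sum_(l < 4) partial l (partial l f) x.

Definition harmonic_on U f : Prop :=
  C2_on U f /\ forall x, U x -> laplacian f x = 0.

(* Class C^1 on the closure of the open set [U]: [f] and its first partial
   derivatives extend continuously from [U] to [closure U].  The values of [f]
   outside [U] play no role. *)
Definition C1_on_closure U f : Prop :=
  C1_on U f /\
  forall x, closure U x ->
    cvg (f y @[y --> within U (nbhs x)]) /\
    forall l, cvg (partial l f y @[y --> within U (nbhs x)]).

End Calculus.
Arguments evec {R}.

Definition boundary (R : realType) (U : set (quat R)) : set (quat R) :=
  closure U `\` interior U.

Section Wirtinger.
Variable R : realType.
Implicit Types (U : set (quat R)) (g h : quat R -> R[i]) (x : quat R).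

Definition cpartial (l : 'I_4) g x : R[i] :=
  partial l (fun y => Re (g y)) x +i* partial l (fun y => Im (g y)) x.

(* [k = 0, 1] stands for the variable z_(k+1) = x_(2k) + i x_(2k+1).
   ['i%C] is the literal [0 +i* 1], not the square root of -1 chosen abstractly
   by the numClosedFieldType structure. *)
Definition re_idx (k : 'I_2) : 'I_4 := if k == 0 then 0 else 2.
Definition im_idx (k : 'I_2) : 'I_4 := if k == 0 then 1 else 3.

Definition dz (k : 'I_2) g x : R[i] :=
  2^-1 * (cpartial (re_idx k) g x - 'i%C * cpartial (im_idx k) g x).

Definition dzbar (k : 'I_2) g x : R[i] :=
  2^-1 * (cpartial (re_idx k) g x + 'i%C * cpartial (im_idx k) g x).

(* Value at [x] of the continuous extension to [closure U] of a function
   given on the open set [U]. *)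
Definition ext U h x : R[i] :=
  lim (Re (h y) @[y --> within U (nbhs x)]) +i*
  lim (Im (h y) @[y --> within U (nbhs x)]).

(* The action T(f1 + f2 j) = T(f1) + T(f2) j on H-valued functions of an
   operator T defined on complex-valued functions. *)
Definition onH (T : (quat R -> R[i]) -> quat R -> R[i])
    (f : quat R -> quat R) x : quat R :=
  c2q (T (fun y => qc1 (f y)) x) + c2q (T (fun y => qc2 (f y)) x) * qj.

Definition psi_regular U (f : quat R -> quat R) : Prop :=
  C1_on U f /\
  forall x, U x -> onH (dzbar 0) f x + qj * onH (dzbar 1) f x = 0.

End Wirtinger.

Section Boundary.
Variable R : realType.
Implicit Types (U : set (quat R)) (rho : quat R -> R) (g : quat R -> R[i])
  (x : quat R).

Definition bounded_domain U : Prop :=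
  [/\ U !=set0, open U, connected U & bounded_set U].

Definition C1_defining U rho : Prop :=
  [/\ C1_on setT rho,
      U = [set x | rho x < 0] &
      forall x, boundary U x -> ('d rho x : quat R -> R) <> cst 0].

Definition dbar_norm rho x : R[i] :=
  sqrtC (\sum_(k < 2) `|dzbar k (fun y => (rho y)%:C) x| ^+ 2).

Definition dbar_n U rho g x : R[i] :=
  (dbar_norm rho x)^-1 *
  \sum_(k < 2) dz k (fun y => (rho y)%:C) x * ext U (dzbar k g) x.

Definition Lop U rho g x : R[i] :=
  (dbar_norm rho x)^-1 *
  (dzbar 1 (fun y => (rho y)%:C) x * ext U (dzbar 0 g) x
   - dzbar 0 (fun y => (rho y)%:C) x * ext U (dzbar 1 g) x).

End Boundary.

(* Main.v *)
(* Write D = d/dzbar_1 + j d/dzbar_2.  On the boundary, (dbar_n - jL) f equals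
   |dbar rho|^-1 (d rho/dz_1 - (d rho/dz_2) j) D f, and the left factor is an
   invertible quaternion because d rho <> 0; so the boundary condition says that
   D f vanishes on the boundary.  If D f = 0 inside, this holds by continuity.
   Conversely, each real component u of D f is a linear combination of first
   partial derivatives of the components of f, hence the locally uniform limit of
   combinations of difference quotients, which are C^2 and harmonic.  The
   maximum principle passes to the limit, so u = 0 as soon as u tends to 0 at
   the boundary. *)
Require Import Defs.
From mathcomp Require Import all_boot all_order all_algebra.
From mathcomp Require Import all_classical all_reals all_analysis.
From mathcomp Require Import complex.
From mathcomp Require Import ring lra.
Set Implicit Arguments.
Unset Strict Implicit.
Unset Printing Implicit Defensive.
Import Order.TTheory GRing.Theory Num.Theory.
Import numFieldNormedType.Exports.
Local Open Scope classical_set_scope.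
Local Open Scope ring_scope.

(** * Directional derivatives *)

Section DirectionalDerivative.
Context {R : realType} {V : normedModType R}.
Implicit Types (phi : V -> R) (x v : V).

Lemma is_derive_line phi x v (t : R) :
  derivable phi (t *: v + x) v ->
  is_derive t 1 (fun s : R => phi (s *: v + x)) ('D_v phi (t *: v + x)).
Proof.
have E : (fun h : R => h^-1 *: (((fun s => phi (s *: v + x)) \o shift t) (h *: 1)
    - phi (t *: v + x))) =
  (fun h => h^-1 *: ((phi \o shift (t *: v + x)) (h *: v) - phi (t *: v + x))).
  by apply/funext => h /=; rewrite [h *: 1]mulr1 scalerDl addrA.
move=> dphi; apply: DeriveDef; first by rewrite /derivable E.
by rewrite /derive E.
Qed.

Lemma derivable_translate phi (a x v : V) :
  derivable (fun y => phi (a + y)) x v <-> derivable phi (a + x) v.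
Proof.
rewrite /derivable (_ : (fun h : R => h^-1 *: (((fun y => phi (a + y)) \o shift x) (h *: v)
    - phi (a + x))) =
  (fun h => h^-1 *: ((phi \o shift (a + x)) (h *: v) - phi (a + x))))//.
by apply/funext => h /=; rewrite addrCA.
Qed.

Lemma derive_translate phi (a x v : V) :
  'D_v (fun y => phi (a + y)) x = 'D_v phi (a + x).
Proof.
rewrite /derive (_ : (fun h : R => h^-1 *: (((fun y => phi (a + y)) \o shift x) (h *: v)
    - phi (a + x))) =
  (fun h => h^-1 *: ((phi \o shift (a + x)) (h *: v) - phi (a + x))))//.
by apply/funext => h /=; rewrite addrCA.
Qed.

Lemma cvg_translate (a x : V) : a + y @[y --> x] --> a + x.
Proof. by apply: cvgD; [exact: cvg_cst|exact: cvg_id]. Qed.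

(** The mean value theorem for [phi] restricted to the line through [x] in direction [v]. Both signs
    of [t] occur, since limits at 0 are two-sided, so the intermediate point is written as a
    fraction [s] of [t]. *)
Lemma MVT_line phi x v (t : R) : t != 0 ->
  (forall s, 0 <= s <= 1 -> derivable phi ((s * t) *: v + x) v) ->
  exists2 s, 0 < s < 1 &
    phi (t *: v + x) - phi x = t * 'D_v phi ((s * t) *: v + x).
Proof.
move=> t0 dphi.
pose g (s : R) : R := phi (s *: v + x).
have dg s : 0 <= s / t <= 1 -> is_derive s 1 g ('D_v phi (s *: v + x)).
  by move=> /dphi; rewrite (divfK t0); exact: is_derive_line.
have cg a b : (forall s, s \in `[a, b] -> 0 <= s / t <= 1) ->
    {within `[a, b], continuous g}.
  move=> ab; apply: derivable_within_continuous => s /ab /dg ds.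
  exact: ex_derive.
have g0 : g 0 = phi x by rewrite /g scale0r add0r.
rewrite -g0 -/(g t).
have [tn|tp|/eqP] := ltgtP t 0; last by rewrite (negbTE t0).
- have tab s : s \in `[t, 0] -> 0 <= s / t <= 1.
    rewrite in_itv/= => /andP[ts s0]; rewrite ler_ndivlMr// ler_ndivrMr// mul0r mul1r.
    by rewrite s0 ts.
  have [||c] := @MVT _ g (fun s => 'D_v phi (s *: v + x)) t 0 tn.
  + by move=> s /subset_itv_oo_cc /tab /dg.
  + exact: cg.
  rewrite in_itv/= => /andP[tc c0] E; exists (c / t).
    by rewrite ltr_ndivlMr// ltr_ndivrMr// mul0r mul1r tc c0.
  rewrite divfK//; move: E; rewrite sub0r => E.
  by rewrite -opprB E; ring.
- have tab s : s \in `[0, t] -> 0 <= s / t <= 1.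
    rewrite in_itv/= => /andP[ts s0]; rewrite ler_pdivlMr// ler_pdivrMr// mul0r mul1r.
    by rewrite s0 ts.
  have [||c] := @MVT _ g (fun s => 'D_v phi (s *: v + x)) 0 t tp.
  + by move=> s /subset_itv_oo_cc /tab /dg.
  + exact: cg.
  rewrite in_itv/= => /andP[tc c0] E; exists (c / t).
    by rewrite ltr_pdivlMr// ltr_pdivrMr// mul0r mul1r tc c0.
  by rewrite divfK// E subr0 mulrC.
Qed.

Lemma near_line (P : set V) x v : (\forall y \near x, P y) ->
  \forall t \near (0 : R), P (t *: v + x).
Proof.
move=> nP; have : (fun t : R => t *: v + x) @ (0 : R) --> x.
  rewrite -[X in _ --> X]add0r -(scale0r v).
  by apply: cvgD; [apply: cvgZr_tmp; exact: cvg_id|exact: cvg_cst].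
exact.
Qed.

(** The first derivative vanishes at the maximum. Were the second one positive, ['D_v phi] would be
    positive at all nearby points [s *: v + x] with [s > 0], and by the mean value theorem [phi]
    would exceed [phi x] there. *)
Lemma second_derivative_local_max phi x v :
  (\forall y \near x, phi y <= phi x) ->
  (\forall y \near x, derivable phi y v) ->
  derivable ('D_v phi) x v -> 'D_v ('D_v phi) x <= 0.
Proof.
move=> xmax dphi ddphi; rewrite leNgt; apply/negP => pos.
have [e /= e0 He] := near_line v (filterI xmax dphi).
have ine (s : R) : `|s| < e -> phi (s *: v + x) <= phi x /\ derivable phi (s *: v + x) v.
  by move=> se; have [] := He s; rewrite /ball_/= ?sub0r ?normrN.
have D0 : 'D_v phi x = 0.
  have itvE (s : R) : s \in `](- e), e[ -> `|s| < e.
    by rewrite in_itv/= ltr_norml.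
  have H := @derive1_at_max _ (fun s : R => phi (s *: v + x)) (- e) e 0.
  have {H} : is_derive (0 : R) 1 (fun s : R => phi (s *: v + x)) 0.
    apply: H.
    - by rewrite ge0_cp// ltW.
    - by move=> s /itvE /ine[_ /is_derive_line ds]; exact: ex_derive.
    - by rewrite in_itv/= oppr_lt0 e0.
    - by move=> s /itvE /ine[]; rewrite scale0r add0r.
  have [|_ /(is_derive_line (t := 0)) d0] := ine 0; first by rewrite normr0.
  move=> d1; have := derive_val (is_derive := d1).
  by rewrite (derive_val (is_derive := d0)) scale0r add0r.
(* The positive second derivative itself serves as epsilon: quotients closer to it than this are
   positive. *)
have := ddphi; rewrite /derivable => /cvgrPdist_lt/(_ _ pos)[d /= d0 Hd].
set t := (Num.min d e) / 2.
have m0 : 0 < Num.min d e by rewrite lt_min d0.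
have t0 : 0 < t by rewrite divr_gt0.
have [td te] : t < d /\ t < e.
  apply/andP; rewrite -lt_min /t ltr_pdivrMr//.
  by rewrite ltr_pMr// ltr1n.
have [||s /andP[s0 s1]] := @MVT_line phi x v t; first exact: lt0r_neq0.
  move=> s /andP[s0 s1]; have [] := ine (s * t) => //.
  rewrite ger0_norm ?mulr_ge0// ?ltW//.
  by rewrite (le_lt_trans _ te)// ler_piMl// ltW.
have st0 : 0 < s * t by rewrite mulr_gt0.
have std : s * t < d by rewrite (le_lt_trans _ td)// ler_piMl// ltW.
have [|le _ E] := ine t; first by rewrite gtr0_norm.
have : 'D_v phi ((s * t) *: v + x) <= 0.
  by move: le; rewrite -subr_le0 E pmulr_rle0.
have {Hd} : `|'D_v ('D_v phi) x - (s * t)^-1 *: ('D_v phi ((s * t) *: v + x) - 'D_v phi x)|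
    < 'D_v ('D_v phi) x.
  by apply: Hd; [rewrite /ball_/= sub0r normrN gtr0_norm|exact: lt0r_neq0].
rewrite D0 subr0 => /ltr_normlW; rewrite gtrBl => pos' le0.
by move: pos'; rewrite ltNge => /negP; apply; rewrite /GRing.scale/= pmulr_rle0// invr_gt0.
Qed.

(** The limit is joint in the base point and the increment, which expresses local uniformity. By the
    mean value theorem the quotient is a value of ['D_v phi] on a short segment near [x], where
    continuity applies. *)
Lemma difference_quotient_cvg phi x v :
  (\forall y \near x, derivable phi y v) -> {for x, continuous ('D_v phi)} ->
  z.2^-1 * (phi (z.2 *: v + z.1) - phi z.1) - 'D_v phi z.1
    @[z --> filter_prod (nbhs x) (0 : R)^'] --> (0 : R).
Proof.
move=> dphi cphi; apply/cvgr0Pnorm_lt => e e0.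
have e20 : 0 < e / 2 by rewrite divr_gt0.
have /cvgrPdist_lt/(_ _ e20) cphi' := cphi.
have [r /= r0 Hr] := (nbhs_normP _ _).1 (filterI dphi cphi').
have {}Hr y : `|x - y| < r -> derivable phi y v /\ `|'D_v phi x - 'D_v phi y| < e / 2.
  by move=> yr; exact: Hr.
have r20 : 0 < r / 2 by rewrite divr_gt0.
(* With these two radii the whole segment from [y] to [h *: v + y] stays in the ball of radius
   [r]. *)
pose A := [set y : V | `|x - y| < r / 2].
pose B := [set h : R | h != 0 /\ `|h| * `|v| < r / 2].
exists (A, B) => /=.
  split; first by apply/nbhs_normP; exists (r / 2).
  have : (fun h : R => `|h| * `|v|) @ 0 --> (0 : R).
    rewrite -[X in _ --> X](mul0r `|v|) -[X in X * _](normr0 R).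
    by apply: cvgMl; apply: cvg_norm; exact: cvg_id.
  move=> /cvgr0Pnorm_lt/(_ _ r20) hr.
  apply: filterS2 (nbhs_dnbhs_neq (0 : R)) (nbhs_dnbhs hr) => h h0.
  by rewrite normrM !normr_id.
move=> [y h] [/= yA [h0 hB]].
have ball_y s : 0 <= s <= 1 -> `|x - ((s * h) *: v + y)| < r.
  move=> /andP[s0 s1]; rewrite opprD addrCA addrC (le_lt_trans (ler_normB _ _))//.
  rewrite (splitr r) ltrD// normrZ normrM (ger0_norm s0) (le_lt_trans _ hB)// -mulrA.
  by rewrite ler_piMl// mulr_ge0.
have [|s /andP[s0 s1] ->] := MVT_line (phi := phi) (x := y) (v := v) h0.
  by move=> s /ball_y /Hr[].
rewrite mulKf//.
have /Hr[_ b1] : `|x - ((s * h) *: v + y)| < r by apply: ball_y; rewrite !ltW.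
have /Hr[_ b2] : `|x - y| < r by rewrite (lt_trans yA)// ltr_pdivrMr// ltr_pMr// ltr1n.
rewrite -(subrKA ('D_v phi x)) (le_lt_trans (ler_normD _ _))// (splitr e) ltrD//.
by rewrite distrC.
Qed.

Lemma cvg_line x v :
  z.2 *: v + z.1 @[z --> filter_prod (nbhs x) (0 : R)^'] --> x.
Proof.
rewrite -[X in _ --> X]add0r -(scale0r v); apply: cvgD; last exact: cvg_fst.
apply: cvgZr_tmp; apply: cvg_trans (@cvg_snd _ _ _ _ _) _.
exact: cvg_within.
Qed.

End DirectionalDerivative.

(** * Maximum principle *)

Section MaximumPrinciple.
Variable R : realType.
Implicit Types (phi psi : quat R -> R) (x y a : quat R) (U : set (quat R)).

(* Weaker than C^2, but enough for the second derivative test. *)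
Definition has_laplacian phi x (k : R) : Prop :=
  [/\ {for x, continuous phi},
      forall l, \forall y \near x, derivable phi y (evec l),
      forall l, derivable (partial l phi) x (evec l) &
      laplacian phi x = k].

Lemma has_laplacian_cst (c : R) x : has_laplacian (cst c) x 0.
Proof.
have E l : partial l (cst c : quat R -> R) = cst 0.
  by apply/funext => y; exact: derive_cst.
split.
- exact: cst_continuous.
- by move=> l; apply: (nearW (F := nbhs x)) => y; exact: derivable_cst.
- by move=> l; rewrite E; exact: derivable_cst.
- by apply: big1 => l _; rewrite E; exact: derive_cst.
Qed.

(** The partial derivatives of the sum split on a neighbourhood of [x], which suffices to
    differentiate the identity once more at [x]. *)
Lemma has_laplacianD phi psi x (k m : R) :
  has_laplacian phi x k -> has_laplacian psi x m ->
  has_laplacian (phi + psi) x (k + m).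
Proof.
move=> [c1 d1 dd1 <-] [c2 d2 dd2 <-].
have E l : \forall y \near x,
    (partial l phi + partial l psi) y = partial l (phi + psi) y.
  by apply: (filterS2 (F := nbhs x)) (d1 l) (d2 l) => y ? ?; rewrite /partial deriveD.
split.
- exact: continuousD.
- by move=> l; apply: (filterS2 (F := nbhs x)) (d1 l) (d2 l) => y ? ?; exact: derivableD.
- by move=> l; apply: near_eq_derivable (E l) _; exact: derivableD.
- rewrite /laplacian -big_split/=; apply: eq_bigr => l _.
  by rewrite {1}/partial -(near_eq_derive _ (E l)) deriveD.
Qed.

Lemma has_laplacianZ (c : R) phi x (k : R) :
  has_laplacian phi x k -> has_laplacian (c \*: phi) x (c * k).
Proof.
move=> [c1 d1 dd1 <-].
have E l : \forall y \near x, (c \*: partial l phi) y = partial l (c \*: phi) y.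
  by apply: (filterS (F := nbhs x)) (d1 l) => y ?; rewrite /partial deriveZ.
split.
- by apply: continuousZl_tmp.
- by move=> l; apply: (filterS (F := nbhs x)) (d1 l) => y ?; exact: derivableZ.
- by move=> l; apply: near_eq_derivable (E l) _; exact: derivableZ.
- rewrite /laplacian mulr_sumr; apply: eq_bigr => l _.
  by rewrite {1}/partial -(near_eq_derive _ (E l)) deriveZ.
Qed.

Lemma has_laplacian_sum (I : Type) (s : seq I) (F : I -> quat R -> R) x :
  (forall i, has_laplacian (F i) x 0) ->
  has_laplacian (fun y => \sum_(i <- s) F i y) x 0.
Proof.
move=> HF; elim: s => [|i s IH].
  by under eq_fun do rewrite big_nil; exact: has_laplacian_cst.
under eq_fun do rewrite big_cons.
by have := has_laplacianD (HF i) IH; rewrite addr0.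
Qed.

Lemma has_laplacian_translate phi a x (k : R) :
  has_laplacian phi (a + x) k -> has_laplacian (fun y => phi (a + y)) x k.
Proof.
move=> [c1 d1 dd1 <-].
have ca := @cvg_translate _ _ a x.
have E l : partial l (fun y => phi (a + y)) = fun y => partial l phi (a + y).
  by apply/funext => y; exact: derive_translate.
split.
- by apply: continuous_comp; [exact: ca|exact: c1].
- by move=> l; apply: (filterS (F := nbhs x)) (ca _ (d1 l)) => y; exact: (derivable_translate _ _ _ _).2.
- by move=> l; rewrite E; exact: (derivable_translate _ _ _ _).2.
- by apply: eq_bigr => l _; rewrite E; exact: derive_translate.
Qed.

(** The perturbation for the maximum principle: a small positive multiple of this function makes a
    zero Laplacian strictly positive. *)
Lemma has_laplacian_sqr_coord x : has_laplacian (fun y => y 0 0 ^+ 2) x 2.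
Proof.
have dc l y : is_derive y (evec l) (fun z : quat R => z 0 0) ((l == 0)%:R).
  have d : derivable (fun z : 'rV[R]_4 => z) y (evec l) by exact: derivable_id.
  have := derive_mx d; rewrite derive_id => /(congr1 (fun M : 'rV[R]_4 => M 0 0)).
  rewrite !mxE/= eq_sym => ->; apply/derivableP.
  by move/derivable_mxP : d; exact.
have dd l y : is_derive y (evec l) (fun z : quat R => z 0 0 ^+ 2) (2 * (l == 0)%:R * y 0 0).
  have := is_deriveX 1 (dc l y).
  rewrite expr1 => H; apply: is_derive_eq.
  by rewrite /GRing.scale/=; ring.
have E l : partial l (fun z : quat R => z 0 0 ^+ 2) = (2 * (l == 0)%:R) \*: (fun z => z 0 0).
  by apply/funext => y; rewrite /partial derive_val.
split.
- have c0 : {for x, continuous (fun y : quat R => y 0 0)} by exact: coord_continuous.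
  by under [X in {for x, continuous X}]eq_fun do rewrite expr2; exact: continuousM.
- by move=> l; apply: (nearW (F := nbhs x)) => y.
- by move=> l; rewrite E; apply: derivableZ.
- rewrite /laplacian (bigD1 0)//= big1 => [|l l0]; rewrite {1}/partial E deriveZ//.
    by rewrite derive_val eqxx addr0 /GRing.scale/=; ring.
  by rewrite (negbTE l0) mulr0 scale0r.
Qed.

Lemma has_laplacian_local_max phi x (k : R) :
  has_laplacian phi x k -> (\forall y \near x, phi y <= phi x) -> k <= 0.
Proof.
move=> [_ d dd <-] xmax; apply: sumr_le0 => l _.
exact: (second_derivative_local_max xmax (d l) (dd l)).
Qed.

(* The function [u] is only a locally uniform limit of functions with zero
   Laplacian: this is how the C^1 function D f is handled without elliptic
   regularity. *)
Lemma maximum_principle U (u : quat R -> R) (uh : R -> quat R -> R) :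
  open U -> bounded_set U -> (forall x, U x -> {for x, continuous u}) ->
  (forall x, boundary U x -> u y @[y --> within U (nbhs x)] --> 0) ->
  (forall x, U x ->
    uh z.2 z.1 - u z.1 @[z --> filter_prod (nbhs x) (0 : R)^'] --> 0) ->
  (forall x, U x ->
    \forall z \near filter_prod (nbhs x) (0 : R)^', has_laplacian (uh z.2) z.1 0) ->
  forall x, U x -> u x <= 0.
Proof.
move=> oU bU cu bdry uhu uh0 x0 Ux0; rewrite leNgt; apply/negP => M0.
set M := u x0 in M0.
(* Since [u] tends to 0 at the boundary and [M / 4] is positive, this superlevel set stays away from
   the boundary, hence is compact. *)
pose K := [set x | U x /\ M / 4 <= u x].
have M40 : 0 < M / 4 by rewrite divr_gt0.
have Kx0 : K x0 by split => //; rewrite ler_pdivrMr// ler_peMr ?ler1n// ltW.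
have clK (x : quat R) : closure K x -> K x.
  move=> clKx.
  have [Ux|nUx] := pselect (U x).
    split => //; rewrite leNgt; apply/negP => ux.
    have /clKx[y [[_ uy1] uy2]] : nbhs x [set y | u y < M / 4].
      exact: (cvgr_lt _ (cu _ Ux)).
    by move: uy1; rewrite leNgt uy2.
  have bx : boundary U x.
    split; last by move/interior_subset.
    by apply: closure_subset clKx => y [].
  have /clKx[y [[Uy uy1] uy2]] : nbhs x [set y | U y -> u y < M / 4].
    exact: (cvgr_lt _ (bdry _ bx)).
  by move: uy1; rewrite leNgt uy2.
have cK : compact K.
  apply: bounded_closed_compact; last exact: clK.
  by apply: (filterS (F := +oo%R)) bU => N UN x [Ux _]; exact: UN.
have [C C0 HC] : exists2 C, 0 < C & forall x, U x -> x 0 0 ^+ 2 <= C.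
  have [N [Nr HN]] := bU.
  pose B := Num.max 0 N + 1.
  have B0 : 0 < B by rewrite ltr_wpDl// le_max lexx.
  have NB : N < B by rewrite ltr_pwDr// le_max lexx orbT.
  exists (B ^+ 2) => [|x Ux]; first by rewrite exprn_gt0.
  rewrite -real_normK ?num_real// lerXn2r ?nnegrE ?(ltW B0)//.
  apply: le_trans (HN _ NB _ Ux).
  rewrite [leRHS]/Num.Def.normr/= mx_normrE.
  exact: (le_bigmax _ (fun i : 'I_1 * 'I_4 => `|x i.1 i.2|) (0, 0)).
(* Chosen so that the perturbation [d * x 0 0 ^+ 2] lies between 0 and [M / 4] on [U]. *)
pose d := M / (4 * C).
have d0 : 0 < d by rewrite divr_gt0// mulr_gt0.
have M80 : 0 < M / 8 by rewrite divr_gt0.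
(* Compactness of [K] turns the local joint limits into one increment [h] that works at every point
   of [K]. *)
have near_h : \forall h \near (0 : R)^', K `<=` (fun y =>
    `|uh h y - u y| < M / 8 /\ has_laplacian (uh h) y 0).
  apply: (compact_near_coveringP K).1 cK R (0 : R)^' _ _ _ => x [Ux _].
  have /cvgr0Pnorm_lt/(_ _ M80) h1 := uhu x Ux.
  exact: filterI h1 (uh0 x Ux).
have [h Kh] := @filter_ex R (0 : R)^' _ _ near_h.
pose v := uh h + d \*: (fun y : quat R => y 0 0 ^+ 2).
have lv x : K x -> has_laplacian v x (d * 2).
  move=> /Kh[_ H]; rewrite -[d * 2]add0r; apply: has_laplacianD H _.
  by apply: has_laplacianZ; exact: has_laplacian_sqr_coord.
have [c] : exists2 c, c \in K & forall t, t \in K -> v t <= v c.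
  apply: EVT_max_rV cK _; first by exists x0.
  by apply: continuous_in_subspaceT => x; rewrite inE => /lv[].
rewrite inE => Kc vmax.
(* Comparing [v c] with [v x0] gives [u c > M - M/8 - M/8 - M/4 = M/2]. The strict inequality puts a
   neighbourhood of [c] inside [K], so [c] is a local maximum of [v], whose Laplacian there is
   [d * 2 > 0]. *)
have uc : M / 4 < u c.
  have := vmax x0; rewrite inE => /(_ Kx0).
  rewrite -[v x0]/(uh h x0 + d * x0 0 0 ^+ 2) -[v c]/(uh h c + d * c 0 0 ^+ 2) => v0c.
  have [/ltr_normlP[a1 a2] _] := Kh _ Kc.
  have [/ltr_normlP[b1 b2] _] := Kh _ Kx0.
  have x2 : 0 <= d * x0 0 0 ^+ 2 by rewrite mulr_ge0 ?sqr_ge0 ?ltW.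
  have c2 : d * c 0 0 ^+ 2 <= M / 4.
    have -> : M / 4 = d * C by rewrite /d invfM mulrA divfK ?gt_eqF.
    by rewrite ler_pM2l// HC//; case: Kc.
  rewrite -/M in b1 b2.
  lra.
suff : d * 2 <= 0 by rewrite leNgt mulr_gt0.
have Uc : U c by case: Kc.
have n1 : \forall y \near c, U y by exact: open_nbhs_nbhs.
have n2 : \forall y \near c, M / 4 < u y by exact: (cvgr_gt _ (cu _ Uc)).
have nmax : \forall y \near c, v y <= v c.
  apply: (filterS2 (F := nbhs c)) n1 n2 => y Uy uy.
  by apply: vmax; rewrite inE; split => //; exact: ltW.
exact: has_laplacian_local_max (lv _ Kc) nmax.
Qed.

End MaximumPrinciple.

(** * First derivatives of harmonic functions *)

Lemma cvg_sumr (R : realType) (T I : Type) (F : set_system T) {FF : Filter F}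
    (s : seq I) (g : I -> T -> R) (a : I -> R) :
  (forall i, g i t @[t --> F] --> a i) ->
  \sum_(i <- s) g i t @[t --> F] --> \sum_(i <- s) a i.
Proof.
move=> ga; elim: s => [|i s IH].
  by under eq_fun do rewrite big_nil; rewrite big_nil; exact: cvg_cst.
by under eq_fun do rewrite big_cons; rewrite big_cons; exact: cvgD.
Qed.

Section Jacobian.
Variable R : realType.
Implicit Types (f : quat R -> quat R) (x y : quat R) (U : set (quat R)).

Definition jac f y : 'M[R]_4 := \matrix_(l, c) partial l (fun z => f z 0 c) y.

Lemma partial_coord f l c y : derivable f y (evec l) ->
  partial l (fun z => f z 0 c) y = partial l f y 0 c.
Proof.
move=> df; have := @derive_mx R (quat R) 1 4 f y (evec l) df.
by move=> /(congr1 (fun M : 'rV[R]_4 => M 0 c)); rewrite mxE => /esym; exact.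
Qed.

Lemma derivable_coord f y (v : quat R) c :
  derivable f y v -> derivable (fun z => f z 0 c) y v.
Proof. by move/(@derivable_mxP R (quat R) 1 4); exact. Qed.

Lemma continuous_coord f x c :
  {for x, continuous f} -> {for x, continuous (fun z => f z 0 c)}.
Proof.
move=> cf; apply: (continuous_comp (g := fun q : 'rV[R]_4 => q 0 c)) cf _.
exact: coord_continuous.
Qed.

(** Stated on a neighbourhood, so that both limits and further derivatives can be carried from the
    vector-valued partials to those of the components. *)
Lemma C1_on_near_partial_coord U f x l c : open U -> C1_on U f -> U x ->
  \forall y \near x, partial l f y 0 c = partial l (fun z => f z 0 c) y.
Proof.
move=> oU Cf Ux; have n1 : \forall y \near x, U y by exact: open_nbhs_nbhs.
apply: (filterS (F := nbhs x)) n1 => y /Cf[/diff_derivable df _].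
by rewrite partial_coord.
Qed.

Lemma continuous_partial_coord U f x l c : open U -> C1_on U f -> U x ->
  {for x, continuous (partial l (fun z => f z 0 c))}.
Proof.
move=> oU Cf Ux; have [df /(_ l) cf] := Cf x Ux.
have := continuous_coord (c := c) cf; rewrite /prop_for/continuous_at.
have d : derivable f x (evec l) by exact: diff_derivable.
rewrite (partial_coord c d) => {}cf.
have E := C1_on_near_partial_coord l c oU Cf Ux.
exact: cvg_trans (near_eq_cvg (F := nbhs x) E) cf.
Qed.

Lemma harmonic_coord U f x c : open U -> harmonic_on U f -> U x ->
  has_laplacian (fun z => f z 0 c) x 0.
Proof.
move=> oU [[Cf C2f] lapf] Ux; have n1 : \forall y \near x, U y by exact: open_nbhs_nbhs.
have E l := C1_on_near_partial_coord l c oU Cf Ux.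
have d2 l : derivable (partial l f) x (evec l).
  by have [/diff_derivable] := C2f l x Ux; exact.
split.
- by apply: continuous_coord; apply: differentiable_continuous; have [] := Cf x Ux.
- move=> l; apply: (filterS (F := nbhs x)) n1 => y /Cf[/diff_derivable df _].
  exact: derivable_coord.
- by move=> l; apply: near_eq_derivable (E l) _; exact: derivable_coord.
- have := congr1 (fun q : quat R => q 0 c) (lapf x Ux).
  rewrite /laplacian summxE mxE => lap0; rewrite -[RHS]lap0.
  apply: eq_bigr => l _; rewrite -partial_coord//.
  by rewrite {1}/partial -(near_eq_derive _ (E l)).
Qed.

(** A combination of first partials with constant coefficients is the locally uniform limit of the
    same combination of difference quotients; these are harmonic, being built from [f] and its
    translates. *)
Lemma harmonic_jac_zero U f (B : 'M[R]_4) : open U -> bounded_set U -> harmonic_on U f ->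
  (forall x, boundary U x ->
    \sum_l \sum_c B l c * jac f y l c @[y --> within U (nbhs x)] --> 0) ->
  forall x, U x -> \sum_l \sum_c B l c * jac f x l c = 0.
Proof.
move=> oU bU hf.
(* The maximum principle bounds from above only; it is used for both [B] and [- B]. *)
suff main (B' : 'M[R]_4) : (forall x, boundary U x ->
    \sum_l \sum_c B' l c * jac f y l c @[y --> within U (nbhs x)] --> 0) ->
    forall x, U x -> \sum_l \sum_c B' l c * jac f x l c <= 0.
  move=> bdry x Ux; apply/eqP; rewrite eq_le main//=.
  have N y : \sum_l \sum_c (- B) l c * jac f y l c = - \sum_l \sum_c B l c * jac f y l c.
    by rewrite -sumrN; apply: eq_bigr => l _; rewrite -sumrN; apply: eq_bigr => c _;
      rewrite mxE mulNr.
  rewrite -oppr_le0 -N; apply: main => // z /bdry bz.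
  under eq_fun do rewrite N.
  suff : - (\sum_l \sum_c B l c * jac f y l c) @[y --> within U (nbhs z)] --> (- 0 : R).
    by rewrite oppr0.
  exact: cvgN.
move=> bdry.
have Cf := hf.1.1.
pose uh (h : R) (y : quat R) := \sum_l \sum_c
  B' l c * (h^-1 * (f (h *: evec l + y) 0 c - f y 0 c)).
apply: (@maximum_principle R U _ uh) => // x Ux;
  have cP l c := @continuous_partial_coord U f x l c oU Cf Ux.
- apply: (cvg_sumr (F := nbhs x)) => l; apply: (cvg_sumr (F := nbhs x)) => c.
  apply: (cvgMl_tmp (F := nbhs x)).
  under eq_fun do rewrite mxE; rewrite mxE.
  exact: cP.
- have n1 : \forall y \near x, U y by exact: open_nbhs_nbhs.
  have H : \sum_l \sum_c B' l c * (z.2^-1 * (f (z.2 *: evec l + z.1) 0 c - f z.1 0 c) -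
        partial l (fun y => f y 0 c) z.1) @[z --> filter_prod (nbhs x) (0 : R)^'] -->
      \sum_(l < 4) \sum_(c < 4) B' l c * 0.
    apply: cvg_sumr => l; apply: cvg_sumr => c; apply: cvgMl_tmp.
    apply: difference_quotient_cvg; last exact: cP.
    by apply: (filterS (F := nbhs x)) n1 => y /Cf[/diff_derivable df _]; exact: derivable_coord.
  have E0 : \sum_(l < 4) \sum_(c < 4) B' l c * 0 = 0.
    by rewrite big1// => l _; rewrite big1// => c _; rewrite mulr0.
  rewrite E0 in H; apply: cvg_trans H.
  apply: (near_eq_cvg (F := filter_prod (nbhs x) (0 : R)^')); apply: nearW => z.
  symmetry.
  rewrite /uh -sumrB; apply: eq_bigr => l _; rewrite -sumrB; apply: eq_bigr => c _.
  by rewrite mxE [RHS]mulrBr.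
- have n1 : \forall y \near x, U y by exact: open_nbhs_nbhs.
  (* For small increments the translated points lie in [U] in all four directions at once, so the
     translates of [f] are harmonic there. *)
  have n2 : \forall z \near filter_prod (nbhs x) (0 : R)^',
      forall l, U (z.2 *: evec l + z.1).
    by apply: filter_forall => l; exact: (@cvg_line R (quat R) x (evec l) _ n1).
  have n3 : \forall z \near filter_prod (nbhs x) (0 : R)^', U z.1 by exact: cvg_fst n1.
  apply: filterS2 n2 n3 => -[y h]/= Uyh Uy.
  apply: has_laplacian_sum => l; apply: has_laplacian_sum => c.
  have H1 := has_laplacian_translate (harmonic_coord c oU hf (Uyh l)).
  have H2 := has_laplacianZ (-1) (harmonic_coord c oU hf Uy).
  have := has_laplacianZ (B' l c) (has_laplacianZ h^-1 (has_laplacianD H1 H2)).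
  rewrite mulr0 addr0 !mulr0; congr has_laplacian; apply/funext => z/=.
  by congr (_ * (_ * (_ + _))); exact: mulN1r.
Qed.

End Jacobian.

(** * The psi-regularity operator *)

Section PsiOperator.
Variable R : realType.
Implicit Types (f : quat R -> quat R) (g : quat R -> R[i]) (rho : quat R -> R)
  (x y p q : quat R) (U : set (quat R)) (J : 'M[R]_4).

(** The derivative d/dzbar_(k+1) of the complex function with real part f_c and imaginary part f_c',
    read off the Jacobian. The pairs (0, 1) and (2, 3) give f_1 and f_2. *)
Definition wirtinger_bar (k : 'I_2) (c c' : 'I_4) J : R[i] :=
  Complex ((J (re_idx k) c - J (im_idx k) c') / 2)
          ((J (re_idx k) c' + J (im_idx k) c) / 2).

(* The operator d/dzbar_1 + j d/dzbar_2 in terms of the Jacobian J l c = d_l f_c. *)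
Definition psi_row J : quat R :=
  mkq ((J 0 0 - J 1 1 - J 2 2 + J 3 3) / 2) ((J 0 1 + J 1 0 + J 2 3 + J 3 2) / 2)
      ((J 0 2 - J 1 3 + J 2 0 - J 3 1) / 2) ((J 0 3 + J 1 2 - J 2 1 - J 3 0) / 2).

(** Coordinate [i] of [psi_row] is a linear form in the Jacobian; its coefficients are its values at
    the matrix units. This is the shape that [harmonic_jac_zero] takes. *)
Definition psi_coeff (i : 'I_4) : 'M[R]_4 := \matrix_(l, c) psi_row (delta_mx l c) 0 i.

Lemma ord4P (P : 'I_4 -> Prop) : P 0 -> P 1 -> P 2 -> P 3 -> forall i, P i.
Proof.
move=> h0 h1 h2 h3 [[|[|[|[|//]]]] hl].
- by rewrite (_ : Ordinal hl = 0)//; exact: val_inj.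
- by rewrite (_ : Ordinal hl = 1)//; exact: val_inj.
- by rewrite (_ : Ordinal hl = 2)//; exact: val_inj.
- by rewrite (_ : Ordinal hl = 3)//; exact: val_inj.
Qed.

Lemma sum4 (F : 'I_4 -> R) : \sum_l F l = F 0 + F 1 + F 2 + F 3.
Proof.
rewrite !big_ord_recl big_ord0 addr0 !addrA.
by congr (F _ + F _ + F _ + F _); exact: val_inj.
Qed.

Lemma coordD p q l : (p + q) 0 l = p 0 l + q 0 l. Proof. by rewrite mxE. Qed.

Lemma coordN p l : (- p) 0 l = - p 0 l. Proof. by rewrite mxE. Qed.

Lemma coordZ (a : R) p l : (a *: p) 0 l = a * p 0 l. Proof. by rewrite mxE. Qed.

Lemma psi_row_coord J i : psi_row J 0 i = \sum_l \sum_c psi_coeff i l c * J l c.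
Proof.
have psiD : {morph (fun J => psi_row J 0 i) : J K / J + K}.
  move=> J' K; move: i; apply: ord4P; rewrite /psi_row !mkqE !mxE; ring.
have psi0 : psi_row 0 0 i = 0.
  by move: i {psiD}; apply: ord4P; rewrite /psi_row !mkqE !mxE; ring.
have psiZ (a : R) K : psi_row (a *: K) 0 i = a * psi_row K 0 i.
  by move: i {psiD psi0}; apply: ord4P; rewrite /psi_row !mkqE !mxE; ring.
rewrite {1}[J]matrix_sum_delta (big_morph _ psiD psi0); apply: eq_bigr => l _.
rewrite (big_morph _ psiD psi0); apply: eq_bigr => c _.
by rewrite psiZ mulrC [X in _ = X * _]mxE.
Qed.

Lemma psi_rowE J :
  c2q (wirtinger_bar 0 0 1 J) + c2q (wirtinger_bar 0 2 3 J) * qj +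
  qj * (c2q (wirtinger_bar 1 0 1 J) + c2q (wirtinger_bar 1 2 3 J) * qj) = psi_row J.
Proof. by apply: quatP; rewrite !(coordD, mkqE) /=; field. Qed.

Lemma complex_half : 2^-1 = real_complex R (2^-1).
Proof. by rewrite fmorphV/= rmorph_nat. Qed.

Lemma dzbarE k g x :
  dzbar k g x = Complex
   ((partial (re_idx k) (fun y => complex.Re (g y)) x -
     partial (im_idx k) (fun y => complex.Im (g y)) x) / 2)
   ((partial (re_idx k) (fun y => complex.Im (g y)) x +
     partial (im_idx k) (fun y => complex.Re (g y)) x) / 2).
Proof.
rewrite /dzbar /cpartial complex_half.
move: (partial _ _ x) (partial _ _ x) (partial _ _ x) (partial _ _ x) => a b c d.
by congr Complex => /=; ring.
Qed.

Lemma dzE k g x :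
  dz k g x = Complex
   ((partial (re_idx k) (fun y => complex.Re (g y)) x +
     partial (im_idx k) (fun y => complex.Im (g y)) x) / 2)
   ((partial (re_idx k) (fun y => complex.Im (g y)) x -
     partial (im_idx k) (fun y => complex.Re (g y)) x) / 2).
Proof.
rewrite /dz /cpartial complex_half.
move: (partial _ _ x) (partial _ _ x) (partial _ _ x) (partial _ _ x) => a b c d.
by congr Complex => /=; ring.
Qed.

Lemma dzbar_qc1 k f x :
  dzbar k (fun y => qc1 (f y)) x = wirtinger_bar k 0 1 (jac f x).
Proof. by rewrite dzbarE /wirtinger_bar !mxE. Qed.

Lemma dzbar_qc2 k f x :
  dzbar k (fun y => qc2 (f y)) x = wirtinger_bar k 2 3 (jac f x).
Proof. by rewrite dzbarE /wirtinger_bar !mxE. Qed.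

Lemma psi_jac f x :
  onH (dzbar 0) f x + qj * onH (dzbar 1) f x = psi_row (jac f x).
Proof. by rewrite /onH !dzbar_qc1 !dzbar_qc2 psi_rowE. Qed.

(** Left multiplication by the conjugate of [p] turns [p * q] into |p|^2 [q], and |p|^2 is a nonzero
    real. *)
Lemma mulq_eq0l p q : p != 0 -> p * q = 0 -> q = 0.
Proof.
move=> p0 pq0.
have N0 : \sum_l p 0 l ^+ 2 != 0.
  apply: contra p0; rewrite psumr_eq0 => [|l _]; last exact: sqr_ge0.
  move=> /allP H; apply/eqP/rowP => l; rewrite [RHS]mxE.
  by have := H l; rewrite mem_index_enum sqrf_eq0 => /(_ isT)/eqP.
have E : mkq (p 0 0) (- p 0 1) (- p 0 2) (- p 0 3) * (p * q) = (\sum_l p 0 l ^+ 2) *: q.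
  by apply: quatP; rewrite [RHS]mxE sum4 !mkqE; ring.
by move: E; rewrite pq0 mulr0 => /esym/eqP; rewrite scaler_eq0 (negbTE N0) => /eqP.
Qed.

(* The boundary operator is the left multiple of D f by a conjugate of the
   gradient of rho, up to the normalising factor. *)
Lemma boundary_operatorE (s r0 r1 r2 r3 : R) (a1 a2 b1 b2 : R[i]) :
  let p1 := Complex r0 (- r1) in let p2 := Complex r2 (- r3) in
  let p1' := Complex r0 r1 in let p2' := Complex r2 r3 in
  let s' := real_complex R s in
  c2q (s' * (p1 * a1 + p2 * a2)) + c2q (s' * (p1 * b1 + p2 * b2)) * qj -
  qj * (c2q (s' * (p2' * a1 - p1' * a2)) + c2q (s' * (p2' * b1 - p1' * b2)) * qj) =
  s *: mkq r0 (- r1) (- r2) r3 *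
  (c2q a1 + c2q b1 * qj + qj * (c2q a2 + c2q b2 * qj)).
Proof.
case: a1 a2 b1 b2 => [? ?] [? ?] [? ?] [? ?] /=.
by apply: quatP; rewrite !(coordD, coordN, coordZ, mkqE) /=; ring.
Qed.

(** * Boundary values of the Jacobian *)

Definition jac_ext U f x : 'M[R]_4 :=
  \matrix_(l, c) lim (jac f y l c @[y --> within U (nbhs x)]).

(** Properness makes limits taken from inside [U] unique. *)
Lemma within_closure_proper U x : closure U x -> ProperFilter (within U (nbhs x)).
Proof.
move=> clU; apply: Build_ProperFilter_ex => P /clU[y [Uy Py]].
by exists y; exact: Py.
Qed.

(** The hypothesis provides limits of the vector-valued partials; on [U] their coordinates are the
    entries of the Jacobian, because [f] is differentiable there. *)
Lemma jac_ext_cvg U f x l c : C1_on_closure U f -> closure U x ->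
  jac f y l c @[y --> within U (nbhs x)] --> jac_ext U f x l c.
Proof.
move=> [Cf clf] clx; have [_ /(_ l) cl] := clf x clx.
have PF := within_closure_proper clx.
rewrite [X in _ --> X]mxE; apply/cvg_ex.
exists ((lim (partial l f y @[y --> within U (nbhs x)])) 0 c).
have H : partial l f y 0 c @[y --> within U (nbhs x)] -->
    (lim (partial l f y @[y --> within U (nbhs x)])) 0 c.
  exact: (cvg_comp _ (fun q : quat R => q 0 c) cl (@coord_continuous _ _ _ _ _ _)).
apply: cvg_trans H; apply: (near_eq_cvg (F := within U (nbhs x))).
apply: (nearW (F := nbhs x)) => y /Cf[df _].
have d : derivable f y (evec l) by exact: diff_derivable.
by rewrite -(partial_coord c d) [RHS]mxE.
Qed.

(** The real and imaginary parts of a Wirtinger derivative are linear in the Jacobian, so they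
    commute with the limit at the boundary. *)
Lemma ext_wirtinger U f g k c c' x : C1_on_closure U f -> closure U x ->
  (forall y, g y = wirtinger_bar k c c' (jac f y)) ->
  ext U g x = wirtinger_bar k c c' (jac_ext U f x).
Proof.
move=> Cf clx gE; have PF := within_closure_proper clx.
have cJ l d := @jac_ext_cvg U f x l d Cf clx.
have gRe : (fun y => complex.Re (g y)) =
    (fun y => (jac f y (re_idx k) c - jac f y (im_idx k) c') / 2).
  by apply/funext => y; rewrite gE.
have gIm : (fun y => complex.Im (g y)) =
    (fun y => (jac f y (re_idx k) c' + jac f y (im_idx k) c) / 2).
  by apply/funext => y; rewrite gE.
rewrite /ext gRe gIm /wirtinger_bar; congr Complex; apply: cvg_lim => //;
  apply: (cvgMr_tmp (F := within U (nbhs x))).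
  exact: (cvgB (F := within U (nbhs x))).
exact: (cvgD (F := within U (nbhs x))).
Qed.

Lemma psi_row_cvg U f x i : C1_on_closure U f -> closure U x ->
  \sum_l \sum_c psi_coeff i l c * jac f y l c @[y --> within U (nbhs x)] -->
  psi_row (jac_ext U f x) 0 i.
Proof.
move=> Cf clx; rewrite psi_row_coord.
apply: (cvg_sumr (F := within U (nbhs x))) => l.
apply: (cvg_sumr (F := within U (nbhs x))) => c.
apply: (cvgMl_tmp (F := within U (nbhs x))).
exact: (@jac_ext_cvg U f x l c Cf clx).
Qed.

(** * The gradient of the defining function and the boundary operator *)

Lemma exists_partial_neq0 rho x : differentiable rho x ->
  ('d rho x : quat R -> R) <> cst 0 -> exists l, partial l rho x != 0.
Proof.
move=> drho nz; apply: contrapT => /forallNP H; apply: nz; apply/funext => v.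
have -> : v = \sum_l v 0 l *: evec l by exact: row_sum_delta.
rewrite linear_sum big1// => l _; rewrite linearZ/=.
have := H l; rewrite /partial deriveE// => /negP; rewrite negbK => /eqP ->.
by rewrite scaler0.
Qed.

Lemma half_eq0 (a : R) : (a / 2 == 0) = (a == 0).
Proof. by rewrite mulf_eq0 invr_eq0 pnatr_eq0 orbF. Qed.

Lemma dzbar_real k rho x : dzbar k (fun y => real_complex R (rho y)) x =
  Complex (partial (re_idx k) rho x / 2) (partial (im_idx k) rho x / 2).
Proof.
rewrite dzbarE/= (_ : partial (im_idx k) (fun=> 0) x = 0); last exact: derive_cst.
by rewrite (_ : partial (re_idx k) (fun=> 0) x = 0) ?subr0 ?add0r//; exact: derive_cst.
Qed.

Lemma dz_real k rho x : dz k (fun y => real_complex R (rho y)) x =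
  Complex (partial (re_idx k) rho x / 2) (- (partial (im_idx k) rho x / 2)).
Proof.
rewrite dzE/= (_ : partial (im_idx k) (fun=> 0) x = 0); last exact: derive_cst.
by rewrite (_ : partial (re_idx k) (fun=> 0) x = 0) ?addr0 ?sub0r ?mulNr//; exact: derive_cst.
Qed.

(** The sum of squares under the root vanishes only if all four partials of [rho] do. Its root is
    nonnegative in the order of [R[i]], which forces a zero imaginary part, so the normalising
    factor acts as a real scalar. *)
Lemma dbar_norm_real rho x (l : 'I_4) : partial l rho x != 0 ->
  exists2 s : R, s != 0 & (dbar_norm rho x)^-1 = real_complex R s.
Proof.
move=> dl; pose N := dbar_norm rho x.
have N0 : 0 <= N by rewrite sqrtC_ge0; apply: sumr_ge0 => k _; rewrite exprn_ge0.
have Nn0 : N != 0.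
  rewrite sqrtC_eq0 psumr_eq0 => [|k _]; last by rewrite exprn_ge0.
  apply: contra dl => /allP H.
  have {}H k : partial (re_idx k) rho x = 0 /\ partial (im_idx k) rho x = 0.
    have := H k; rewrite mem_index_enum sqrf_eq0 normr_eq0 dzbar_real => /(_ isT)/eqP[].
    by move=> /eqP + /eqP; rewrite !half_eq0 => /eqP -> /eqP ->.
  apply/eqP; move: l; apply: ord4P.
  - exact: (H 0).1.
  - exact: (H 0).2.
  - exact: (H 1).1.
  - exact: (H 1).2.
have NE : N = real_complex R (complex.Re N).
  by move: N0; rewrite lecE => /andP[/eqP/= N0 _]; case: N N0 {Nn0} => a b /= ->.
exists (complex.Re N)^-1; last by rewrite -/N {1}NE fmorphV.
rewrite invr_eq0; apply: contra Nn0 => /eqP n0.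
by rewrite NE n0.
Qed.

Lemma boundary_operator_eq0 U rho f x : C1_on setT rho ->
  ('d rho x : quat R -> R) <> cst 0 -> C1_on_closure U f -> closure U x ->
  onH (dbar_n U rho) f x - qj * onH (Lop U rho) f x = 0 <->
  psi_row (jac_ext U f x) = 0.
Proof.
move=> Crho drho0 Cf clx; have [drho _] := Crho x I.
have [l dl] := exists_partial_neq0 drho drho0.
have [s s0 sE] := dbar_norm_real dl.
have e1 k : ext U (dzbar k (fun y => qc1 (f y))) x = wirtinger_bar k 0 1 (jac_ext U f x).
  by apply: ext_wirtinger => // y; exact: dzbar_qc1.
have e2 k : ext U (dzbar k (fun y => qc2 (f y))) x = wirtinger_bar k 2 3 (jac_ext U f x).
  by apply: ext_wirtinger => // y; exact: dzbar_qc2.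
have sum2 (F : 'I_2 -> R[i]) : \sum_k F k = F 0 + F 1.
  by rewrite !big_ord_recl big_ord0 addr0; congr (F _ + F _); exact: val_inj.
have nE g a1 a2 : ext U (dzbar 0 g) x = a1 -> ext U (dzbar 1 g) x = a2 ->
    dbar_n U rho g x = real_complex R s *
      (Complex (partial 0 rho x / 2) (- (partial 1 rho x / 2)) * a1 +
       Complex (partial 2 rho x / 2) (- (partial 3 rho x / 2)) * a2).
  by move=> <- <-; rewrite /dbar_n sE sum2 !dz_real.
have LE g a1 a2 : ext U (dzbar 0 g) x = a1 -> ext U (dzbar 1 g) x = a2 ->
    Lop U rho g x = real_complex R s *
      (Complex (partial 2 rho x / 2) (partial 3 rho x / 2) * a1 -
       Complex (partial 0 rho x / 2) (partial 1 rho x / 2) * a2).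
  by move=> <- <-; rewrite /Lop sE !dzbar_real.
(* The left factor is d rho/dz_1 - (d rho/dz_2) j, scaled by the real number [s]. *)
have -> : onH (dbar_n U rho) f x - qj * onH (Lop U rho) f x =
    s *: mkq (partial 0 rho x / 2) (- (partial 1 rho x / 2))
             (- (partial 2 rho x / 2)) (partial 3 rho x / 2) * psi_row (jac_ext U f x).
  rewrite -psi_rowE -boundary_operatorE /onH.
  congr (c2q _ + c2q _ * qj - qj * (c2q _ + c2q _ * qj)).
  - exact: nE (e1 0) (e1 1).
  - exact: nE (e2 0) (e2 1).
  - exact: LE (e1 0) (e1 1).
  - exact: LE (e2 0) (e2 1).
split=> [|->]; last by rewrite mulr0.
apply: mulq_eq0l; rewrite scaler_eq0 negb_or s0/=.
(* The coordinates of this factor are, up to sign, half the partials of [rho], and one of these is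
   nonzero. *)
apply: contra dl => /eqP q0; move: l; apply: ord4P; rewrite -half_eq0.
- by have := congr1 (fun q : quat R => q 0 0) q0; rewrite /= mkqE mxE => ->.
- by have := congr1 (fun q : quat R => q 0 1) q0; rewrite /= mkqE mxE -oppr_eq0 => ->.
- by have := congr1 (fun q : quat R => q 0 2) q0; rewrite /= mkqE mxE -oppr_eq0 => ->.
- by have := congr1 (fun q : quat R => q 0 3) q0; rewrite /= mkqE mxE => ->.
Qed.

End PsiOperator.

(** * Equivalence of psi-regularity and the boundary condition *)

Unset Implicit Arguments.

Theorem theorem2 (R : realType) (Omega : set (quat R)) (rho : quat R -> R)
    (f : quat R -> quat R) :
  bounded_domain Omega ->
  C1_defining Omega rho ->
  harmonic_on Omega f ->
  C1_on_closure Omega f ->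
  psi_regular Omega f <->
  (forall x, boundary Omega x ->
     onH (dbar_n Omega rho) f x - qj * onH (Lop Omega rho) f x = 0).
Proof.
move=> [_ oU _ bU] [Crho _ drho] hf Cf.
have bdryE x : boundary Omega x ->
    (onH (dbar_n Omega rho) f x - qj * onH (Lop Omega rho) f x = 0 <->
     psi_row (jac_ext Omega f x) = 0).
  by move=> bx; apply: boundary_operator_eq0 => //; [exact: drho|case: bx].
split=> [[_ reg] x bx|bc].
  apply/bdryE => //; have [clx _] := bx.
  have PF := within_closure_proper clx.
  apply/rowP => i; rewrite [RHS]mxE.
  have H := @psi_row_cvg R Omega f x i Cf clx.
  (* The same expression is identically 0 on [Omega], so its boundary limit is 0. *)
  apply: (cvg_unique (@norm_hausdorff _ _) H).
  apply: (cvg_near_cst 0 (F := within Omega (nbhs x))).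
  apply: (nearW (F := nbhs x)) => y Uy.
  by rewrite -psi_row_coord -psi_jac reg// mxE.
split; first exact: hf.1.1.
move=> x Ux; rewrite psi_jac; apply/rowP => i; rewrite [RHS]mxE psi_row_coord.
(* Each coordinate of D f is treated separately; the boundary condition says exactly that its limit
   at the boundary is 0. *)
apply: (harmonic_jac_zero oU bU hf) Ux => y by_.
have [cly _] := by_.
have := @psi_row_cvg R Omega f y i Cf cly.
by rewrite ((bdryE y by_).1 (bc y by_)) mxE.
Qed.
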